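(* Let $A\in\mathcal{S}_n^{+}$, where $n\le 3$. Then $\operatorname{rk}(A)=\operatorname{st}_{+}(A)$.
   Context: Here $\mathbb{R}_{+}^{m\times n}$ is the set of $m\times n$ real matrices with nonnegative entries and $\mathcal{S}_n^{+}$ is the set of symmetric $n\times n$ matrices with nonnegative entries. $\operatorname{rk}$ is the usual rank. For $A\in\mathcal{S}_n^{+}$, an SN-Trifactorization of $A$ is a factorization $A=BCB^{T}$ with $B\in\mathbb{R}_{+}^{n\times k}$ and $C\in\mathcal{S}_k^{+}$; the SNT-rank $\operatorname{st}_{+}(A)$ is the smallest integer $k$ for which such a factorization exists, with the convention $\operatorname{st}_{+}(0)=0$. *)

(* Defs.v *)
From HB Require Import structures.
From mathcomp Require Import all_boot all_order all_algebra.
From mathcomp Require Import boolp reals.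

Set Implicit Arguments.
Unset Strict Implicit.
Unset Printing Implicit Defensive.

Import Order.TTheory GRing.Theory Num.Theory.
Local Open Scope ring_scope.

Definition nonneg_mx (R : realType) (m n : nat) (A : 'M[R]_(m, n)) : Prop :=
  forall i j, 0 <= A i j.

Definition sym_nonneg_mx (R : realType) (n : nat) (A : 'M[R]_n) : Prop :=
  A^T = A /\ nonneg_mx A.

Definition is_SNT (R : realType) (n k : nat) (A : 'M[R]_n)
    (B : 'M[R]_(n, k)) (C : 'M[R]_k) : Prop :=
  [/\ nonneg_mx B, sym_nonneg_mx C & A = B *m C *m B^T].

Definition has_SNT (R : realType) (n : nat) (A : 'M[R]_n) (k : nat) : Prop :=
  exists (B : 'M[R]_(n, k)) (C : 'M[R]_k), is_SNT A B C.

Lemma has_SNT_self (R : realType) (n : nat) (A : 'M[R]_n) :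
  sym_nonneg_mx A -> has_SNT A n.
Proof.
move=> hA; exists 1%:M, A; split=> //; last by rewrite trmx1 mulmx1 mul1mx.
by move=> i j; rewrite mxE ler0n.
Qed.

Lemma has_SNT_exists (R : realType) (n : nat) (A : 'M[R]_n) :
  sym_nonneg_mx A -> exists k : nat, `[< has_SNT A k >].
Proof. by move=> hA; exists n; apply/asboolP; exact: has_SNT_self. Qed.

Definition snt_rank (R : realType) (n : nat) (A : 'M[R]_n)
    (hA : sym_nonneg_mx A) : nat :=
  ex_minn (has_SNT_exists hA).

Lemma snt_rankP (R : realType) (n : nat) (A : 'M[R]_n)
    (hA : sym_nonneg_mx A) :
  has_SNT A (snt_rank hA) /\
  (forall k : nat, has_SNT A k -> (snt_rank hA <= k)%N).
Proof.
rewrite /snt_rank; case: ex_minnP => k /asboolP hk kmin; split=> // j hj.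
by apply: kmin; apply/asboolP.
Qed.

(* The convention st_+(0) = 0 needs no separate clause: size 0 is allowed in
   has_SNT, and a product through an empty index set is the zero matrix. *)
Lemma snt_rank0 (R : realType) (n : nat) (h0 : sym_nonneg_mx (0 : 'M[R]_n)) :
  snt_rank h0 = 0%N.
Proof.
apply/eqP; rewrite -leqn0; apply: (snt_rankP h0).2.
exists 0, 0; split; last by rewrite !mul0mx.
- by move=> i j; rewrite mxE.
- by split=> [|i j]; rewrite ?trmx0 // mxE.
Qed.

(* Main.v *)
(** In a nontrivial linear relation between at most three vectors, the positive
    or the negative coefficients number at most one. If the vectors are
    nonnegative, it follows that one of them is a nonnegative combination of the
    others (it vanishes when all coefficients have the same sign). So a singular
    [A] of size at most 3 has a row [k] which is such a combination; by symmetry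
    [A = B A' B^T], where [A'] is [A] without row and column [k] and [B] is
    nonnegative. As [A'] has the same rank, induct on the size until [A] is
    invertible. *)
Require Import Defs.
From HB Require Import structures.
From mathcomp Require Import all_boot all_order all_algebra.
From mathcomp Require Import boolp reals.

Set Implicit Arguments.
Unset Strict Implicit.
Unset Printing Implicit Defensive.

Import Order.TTheory GRing.Theory Num.Theory.
Local Open Scope ring_scope.

Lemma has_SNT_rank_le (R : realType) (n k : nat) (A : 'M[R]_n) :
  has_SNT A k -> (\rank A <= k)%N.
Proof.
move=> [B [C [_ _ ->]]]; rewrite -mulmxA.
exact: leq_trans (mxrankM_maxl _ _) (rank_leq_col _).
Qed.

Lemma mxrank_row' (F : fieldType) (m n : nat) (i : 'I_m) (A : 'M[F]_(m, n)) :
  (\rank (row' i A) <= \rank A)%N.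
Proof. by rewrite row'Esub rowsubE mxrankM_maxr. Qed.

Lemma nonneg_mulmx (R : realType) (m n p : nat)
    (A : 'M[R]_(m, n)) (B : 'M[R]_(n, p)) :
  nonneg_mx A -> nonneg_mx B -> nonneg_mx (A *m B).
Proof. by move=> hA hB i j; rewrite mxE sumr_ge0 // => l _; rewrite mulr_ge0. Qed.

(** [B] is absorbed into the left factor, so the inner size [k] does not grow. *)
Lemma has_SNT_congr (R : realType) (n m k : nat)
    (B : 'M[R]_(n, m)) (A : 'M[R]_m) :
  nonneg_mx B -> has_SNT A k -> has_SNT (B *m A *m B^T) k.
Proof.
move=> hB [D [C [hD hC ->]]]; exists (B *m D), C; split=> //.
  exact: nonneg_mulmx.
by rewrite trmx_mul !mulmxA.
Qed.

Lemma sym_nonneg_principal (R : realType) (n : nat) (k : 'I_n.+1)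
    (A : 'M[R]_n.+1) :
  sym_nonneg_mx A -> sym_nonneg_mx (row' k (col' k A)).
Proof.
move=> [tA hA]; split=> [|i j]; last by rewrite !mxE.
by apply/matrixP => i j; rewrite !mxE -[in LHS]tA mxE.
Qed.

Section InsertRow.
Variables (R : realType) (n : nat) (k : 'I_n.+1) (u : 'rV[R]_n).

(** The identity matrix with [u] inserted as row [k]: multiplying on the left by it restores a
    deleted row [k] that is the combination [u] of the others. *)
Definition insert_row : 'M[R]_(n.+1, n) :=
  \matrix_(i, j) if unlift k i is Some i' then (i' == j)%:R else u 0 j.

Lemma insert_row_nonneg : nonneg_mx u -> nonneg_mx insert_row.
Proof. by move=> hu i j; rewrite mxE; case: unlift => // i'; rewrite ler0n. Qed.

Lemma insert_row_mul (p : nat) (A : 'M[R]_(n.+1, p)) :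
  row k A = u *m row' k A -> insert_row *m row' k A = A.
Proof.
move=> hk; apply/matrixP => i j; rewrite mxE.
case: (unliftP k i) => [i'|] ->.
  rewrite (bigD1 i') //= big1 ?addr0 => [|l /negbTE il].
    by rewrite !mxE liftK eqxx mul1r.
  by rewrite !mxE liftK eq_sym il mul0r.
have /rowP/(_ j) := hk; rewrite !mxE => ->.
by apply: eq_bigr => l _; rewrite !mxE unlift_none.
Qed.

Lemma insert_row_congr (A : 'M[R]_n.+1) :
  A^T = A -> row k A = u *m row' k A ->
  A = insert_row *m row' k (col' k A) *m insert_row^T.
Proof.
move=> tA hk; have BA := insert_row_mul hk.
(* Deleting a column commutes with multiplication on the left; symmetry then turns the restored row
   into a restored column. *)
have BA' : insert_row *m row' k (col' k A) = col' k A.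
  rewrite -[in RHS]BA; apply/matrixP => i j; rewrite !mxE.
  by apply: eq_bigr => l _; rewrite !mxE.
by rewrite BA' -[X in col' k X]tA -tr_row' -trmx_mul BA tA.
Qed.

End InsertRow.

Lemma nonneg_relation_row (R : realType) (n p : nat) (A : 'M[R]_(n.+1, p))
    (c : 'rV[R]_n.+1) :
  nonneg_mx A -> c != 0 -> c *m A = 0 -> (#|[set i | (c 0 i < 0)%R]| <= 1)%N ->
  exists (k : 'I_n.+1) (u : 'rV[R]_n), nonneg_mx u /\ row k A = u *m row' k A.
Proof.
move=> hA c0 cA; have cAE j : \sum_i c 0 i * A i j = 0.
  by move/rowP/(_ j): cA; rewrite !mxE.
case: (pickP (mem [set i | c 0 i < 0])) => [k /[!inE] ck | Neg0] hN.
  move/card_le1_eqP: hN => hN.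
  (* The relation solved for row [k]: [c 0 k] is the only negative coefficient, so these quotients
     are nonnegative. *)
  exists k, (\row_j (c 0 (lift k j) / - c 0 k)); split=> [i j|].
    rewrite mxE divr_ge0 ?oppr_ge0 ?(ltW ck) // leNgt; apply/negP => cj.
    have := hN (lift k j) k; rewrite !inE => /(_ cj ck) /eqP.
    by rewrite (negbTE (neq_lift k j)).
  apply/rowP => j; rewrite !mxE.
  have := cAE j; rewrite (bigD1_ord k) //= => /eqP.
  rewrite addr_eq0 => /eqP e.
  have ck0 : c 0 k != 0 by rewrite lt_eqF.
  apply: (mulfI ck0); rewrite e mulr_sumr -sumrN; apply: eq_bigr => l _.
  by rewrite !mxE invrN mulrN mulNr mulrN mulrA mulrCA divff // mulr1.
have c_ge0 i : 0 <= c 0 i by rewrite leNgt; have := Neg0 i; rewrite !inE => ->.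
(* Each column sum vanishes and has nonnegative terms, so a row with nonzero coefficient is zero and
   [u = 0] works. *)
case/rV0Pn: c0 => k ck; exists k, 0; split=> [i j|]; first by rewrite mxE.
rewrite mul0mx; apply/rowP => j; rewrite !mxE.
have /eqP := cAE j; rewrite psumr_eq0 => [|i _]; last by rewrite mulr_ge0.
by move/allP/(_ k (mem_index_enum _)); rewrite mulf_eq0 (negbTE ck) => /eqP.
Qed.

Lemma nonneg_dependent_row (R : realType) (n p : nat) (A : 'M[R]_(n.+1, p)) :
  (n < 3)%N -> nonneg_mx A -> ~~ row_free A ->
  exists (k : 'I_n.+1) (u : 'rV[R]_n), nonneg_mx u /\ row k A = u *m row' k A.
Proof.
move=> n3 hA; rewrite -kermx_eq0 => /rowV0Pn [c /sub_kermxP cA c0].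
have [|gt1] := leqP #|[set i | (c 0 i < 0)%R]| 1.
  exact: (nonneg_relation_row hA c0 cA).
(* At least two of the at most three coefficients are negative, so [- c] has at most one negative
   entry. *)
apply: (@nonneg_relation_row _ _ _ A (- c)) => //; first by rewrite oppr_eq0.
  by rewrite mulNmx cA oppr0.
have sub : [set i | (- c) 0 i < 0] \subset ~: [set i | c 0 i < 0].
  apply/subsetP => i; rewrite !inE mxE oppr_lt0 -leNgt; exact: ltW.
apply: leq_trans (subset_leq_card sub) _.
rewrite -(leq_add2l #|[set i | (c 0 i < 0)%R]|) cardsC card_ord.
by rewrite (leq_trans n3) // addn1.
Qed.

Lemma has_SNT_mxrank (R : realType) (n : nat) (A : 'M[R]_n) :
  (n <= 3)%N -> sym_nonneg_mx A -> has_SNT A (\rank A).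
Proof.
elim: n A => [|n IHn] A n3 hA.
  have -> : \rank A = 0%N by apply/eqP; rewrite -leqn0 rank_leq_row.
  exact: has_SNT_self.
(* If [A] is invertible, its rank is its size and the trivial factorization suffices. *)
have [/eqP -> | sing] := boolP (row_free A); first exact: has_SNT_self.
have [k [u [hu hk]]] := nonneg_dependent_row n3 hA.2 sing.
have eA := insert_row_congr hA.1 hk.
have hB := insert_row_nonneg k hu.
have hA' := sym_nonneg_principal k hA.
have SNT_A : has_SNT A (\rank (row' k (col' k A))).
  by rewrite [A in has_SNT A _]eA; apply/has_SNT_congr/IHn/hA'/ltnW.
suff -> : \rank A = \rank (row' k (col' k A)) by [].
(* The factorization just found bounds the rank of [A] above; deleting a row and a column cannot
   raise the rank, which gives the other inequality. *)
apply/eqP; rewrite eqn_leq has_SNT_rank_le //=.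
apply: leq_trans (mxrank_row' k (col' k A)) _.
by rewrite -mxrank_tr tr_col' hA.1 mxrank_row'.
Qed.

Theorem corollary2p8 (R : realType) (n : nat) (A : 'M[R]_n)
    (hn : (n <= 3)%N) (hA : sym_nonneg_mx A) :
  \rank A = snt_rank hA.
Proof.
have [st_fact st_min] := snt_rankP hA.
apply/eqP; rewrite eqn_leq has_SNT_rank_le //=.
exact/st_min/has_SNT_mxrank.
Qed.
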